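(* Let $\lambda=\mu>0$ and $N\in\mathbb N$. Let $$P(x)=x\left[\prod_{r=0}^{N-1}\bigl(x+2\mu(2r+1)\bigr)+\prod_{r=0}^{N-1}\bigl(x+2\mu(2r+2)\bigr)\right],\qquad Q(x)=\prod_{r=0}^{N-1}\bigl[x+2\mu(2r+1)\bigr],$$ and let $0=\alpha_1>\alpha_2>\dots>\alpha_{N+1}$ be the roots of $P$. Put, for $k=1,\dots,N+1$, $$\beta_k=\lim_{\eta\to\alpha_k}\frac{P(\eta)}{\eta-\alpha_k}=2\prod_{\substack{s=1\\ s\ne k}}^{N+1}(\alpha_k-\alpha_s).$$ Then for all $t\ge 0$ the probability $p(0,t)$ that the multi-type Ehrenfest system is empty at time $t$ is $$p(0,t)=\rho(0)+2\sum_{k=2}^{N+1}\frac{Q(\alpha_k)}{\beta_k}\,e^{\alpha_k t},$$ where $\rho(0)=\lim_{t\to+\infty}p(0,t)$ is given by $$\rho(0)=\frac{2\binom{2N}{N}}{\binom{2N}{N}+4^N}=\frac{2}{1+\dfrac{\sqrt{\pi}\,N!}{\Gamma(N+1/2)}}.$$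
   Context: Multi-type Ehrenfest model: let $N,d\in\mathbb N$, $D=\{1,\dots,d\}$, $\lambda,\mu>0$, and let $C=(c_{l,j})_{l,j\in D}$ be a stochastic matrix ($c_{l,j}\ge 0$, $\sum_{j}c_{l,j}=1$). The system is a continuous-time Markov chain with states $(k,j)$, $k\in\{1,\dots,N\}$, $j\in D$ ($k$ particles, all of type $j$), and the empty states $(0,l)$, $l\in D$ (no particle, the last particles in the system having been of type $l$). The only transitions are: $(k,j)\to(k-1,j)$ at rate $\mu(N+k)$ for $1\le k\le N$; $(k,j)\to(k+1,j)$ at rate $\lambda(N-k)$ for $1\le k\le N-1$; $(0,l)\to(1,j)$ at rate $c_{l,j}\lambda N$. At time $0$ the chain is in $(0,l_0)$ for a fixed $l_0\in D$. Let $p(k,j,t)$ be the probability of being in state $(k,j)$ at time $t$, $0\le k\le N$, $j\in D$, and $p(k,t)=\sum_{j\in D}p(k,j,t)$ the probability that the number of particles $\mathcal N(t)$ equals $k$ at time $t$; thus $p(0,0)=1$ and $p(k,0)=0$ for $k\geq 1$. *)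

(* Defs.v *)
From HB Require Import structures.
From mathcomp Require Import all_boot all_order all_algebra.
From mathcomp Require Import all_classical all_reals all_analysis.

Set Implicit Arguments.
Unset Strict Implicit.
Unset Printing Implicit Defensive.

Import Order.TTheory GRing.Theory Num.Theory.
Import numFieldNormedType.Exports.

Local Open Scope classical_set_scope.
Local Open Scope ring_scope.

Section MarkovChain.
Context {R : realType} {S : finType}.

(* Only the values [p t i j] for [0 <= t] are relevant. *)
Definition transition_function (p : R -> S -> S -> R) : Prop :=
  [/\ forall t i j, 0 <= t -> 0 <= p t i j,
      forall t i, 0 <= t -> \sum_j p t i j = 1,
      forall i j, p 0 i j = (i == j)%:R &
      forall s t i j, 0 <= s -> 0 <= t ->
        p (s + t) i j = \sum_k p s i k * p t k j].

(* The transition i -> j takes place at rate [q i j]; the diagonal of [q] is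
   irrelevant. *)
Definition has_rates (p : R -> S -> S -> R) (q : S -> S -> R) : Prop :=
  forall i j, i != j -> p h i j / h @[h --> 0^'+] --> q i j.

Context {disp : measure_display} {T : measurableType disp}.

Definition prob_in (P : probability T R) (X : R -> T -> S) (t : R) (i : S) : R :=
  fine (P [set w | X t w = i]).

(* Time-homogeneous Markov property given any finite set of observations made
   up to time t. The conditional probability is written as a product, so that
   nothing is required when the conditioning event is null. *)
Definition markov_property (P : probability T R) (X : R -> T -> S)
    (p : R -> S -> S -> R) : Prop :=
  forall (n : nat) (s : 'I_n -> R) (z : 'I_n -> S) (t h : R) (i j : S),
    (forall m, 0 <= s m <= t) -> 0 <= t -> 0 <= h ->
    fine (P [set w | [/\ forall m, X (s m) w = z m, X t w = i
                       & X (t + h) w = j]]) =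
    fine (P [set w | (forall m, X (s m) w = z m) /\ X t w = i]) * p h i j.

Definition continuous_time_markov_chain (P : probability T R)
    (X : R -> T -> S) (q : S -> S -> R) : Prop :=
  (forall t i, 0 <= t -> measurable [set w | X t w = i]) /\
  exists p : R -> S -> S -> R,
    [/\ transition_function p, has_rates p q & markov_property P X p].

End MarkovChain.

Section Ehrenfest.
Context {R : realType}.

Definition stochastic_matrix (d : nat) (C : 'M[R]_d) : Prop :=
  (forall l j, 0 <= C l j) /\ (forall l, \sum_j C l j = 1).

(* [(k, j)] is the state with k particles, all of type j; [(0, l)] is the empty
   state in which the last particles were of type l. *)
Definition ehrenfest_state (N d : nat) : finType := ('I_N.+1 * 'I_d)%type.

Definition ehrenfest_rate (N d : nat) (lambda mu : R) (C : 'M[R]_d)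
    (x y : ehrenfest_state N d) : R :=
  let: (k, j) := x in
  let: (k', j') := y in
  if (k == k'.+1 :> nat) && (j == j') then mu * (N%:R + k%:R)
  else if k' == k.+1 :> nat then
    if k == 0%N :> nat then C j j' * lambda * N%:R
    else if j == j' then lambda * (N%:R - k%:R) else 0
  else 0.

Definition prob_count (N d : nat) (disp : measure_display)
    (T : measurableType disp) (P : probability T R)
    (X : R -> T -> ehrenfest_state N d) (k : 'I_N.+1) (t : R) : R :=
  \sum_(j < d) prob_in P X t (k, j).

Definition ehrenfest_P (N : nat) (mu : R) : {poly R} :=
  'X * (\prod_(r < N) ('X + (2 * mu * (2 * r%:R + 1))%:P)
        + \prod_(r < N) ('X + (2 * mu * (2 * r%:R + 2))%:P)).

Definition ehrenfest_Q (N : nat) (mu : R) : {poly R} :=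
  \prod_(r < N) ('X + (2 * mu * (2 * r%:R + 1))%:P).

(* [alpha] is indexed from 0. *)
Definition ordered_roots (N : nat) (p : {poly R}) (alpha : 'I_N.+1 -> R) : Prop :=
  [/\ alpha ord0 = 0,
      forall i j : 'I_N.+1, (i < j)%N -> alpha j < alpha i &
      forall x, root p x <-> exists i, x = alpha i].

Definition Gamma (a : R) : R :=
  fine (\int[lebesgue_measure]_(x in `]0%R, +oo[) (x `^ (a - 1) * expR (- x))%:E)%E.

End Ehrenfest.

(* Main.v *)
Require Import Defs.
From HB Require Import structures.
From mathcomp Require Import all_boot all_order all_algebra.
From mathcomp Require Import ring lra zify.
From mathcomp Require Import all_classical all_reals all_analysis.
From mathcomp Require Import measurable_realfun.

Set Implicit Arguments.
Unset Strict Implicit.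
Unset Printing Implicit Defensive.

Import Order.TTheory GRing.Theory Num.Theory.
Import numFieldNormedType.Exports.

Local Open Scope classical_set_scope.
Local Open Scope ring_scope.

(* The function k |-> w_k that solves the eigenvector equation of the generator
   at every k >= 1, started from w_N = 1, is a polynomial of degree N - k in the
   eigenvalue x; with m = N - k it is a Krawtchouk polynomial, i.e. up to scaling
   the coefficient of z^m in (1 - z)^y (1 + z)^(2N - y) at x = - 2 mu y. Since this
   polynomial in z is palindromic up to the sign (-1)^y, evaluating at the integers
   y identifies w_0 with Q, and the remaining equation at k = 0 with P(x) = 0. So
   each root of P yields an eigenfunction of the generator that depends only on
   the number of particles, and Lagrange interpolation at the roots expands the
   indicator function of the empty states in these eigenfunctions. *)

(** * Krawtchouk polynomials and their relation to P and Q *)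

Section Polynomials.
Context {R : realType}.
Implicit Types (p q : {poly R}) (N m n a b y : nat) (mu : R).

Lemma poly_eq_on_points n p q (x : 'I_n -> R) :
  injective x -> (size (p - q)%R <= n)%N -> (forall i, p.[x i] = q.[x i]) ->
  p = q.
Proof.
move=> x_inj sz_pq pqx; apply/eqP; rewrite -subr_eq0; apply/eqP.
apply: (@roots_geq_poly_eq0 _ _ [seq x i | i <- enum 'I_n]).
- apply/allP => _ /mapP[i _ ->].
  by rewrite rootE !hornerE pqx subrr.
- by rewrite map_inj_uniq ?enum_uniq.
- by rewrite size_map size_enum_ord.
Qed.

(** The leading terms cancel, so that two monic polynomials of degree n can be compared at only n
    points. *)
Lemma size_sub_monic n p q :
  p \is monic -> q \is monic -> size p = n.+1 -> size q = n.+1 ->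
  (size (p - q)%R <= n)%N.
Proof.
move=> /monicP lp /monicP lq sp sq.
have sz : (size (p - q)%R <= n.+1)%N.
  by rewrite (leq_trans (size_polyD _ _)) // size_polyN sp sq maxnn.
apply/leq_sizeP => j; rewrite leq_eqVlt => /predU1P[<-|nj].
  by rewrite coefB; move: lp lq; rewrite /lead_coef sp sq /= => -> ->; rewrite subrr.
by move/leq_sizeP: sz; apply.
Qed.

(* Compare the coefficients of degree n in Lagrange's interpolation formula. *)
Lemma sum_divided_difference n p (x : 'I_n.+1 -> R) :
  injective x -> (size p <= n.+1)%N ->
  \sum_k p.[x k] / \prod_(s | s != k) (x k - x s) = p`_n.
Proof.
move=> x_inj szp.
pose L k : {poly R} := \prod_(s | s != k) ('X - (x s)%:P).
have mL k : L k \is monic by apply: monic_prod_XsubC.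
have sL k : size (L k) = n.+1.
  rewrite /L -big_filter size_prod_XsubC.
  rewrite -cardE cardC1 card_ord.
  by [].
have d0 k : \prod_(s | s != k) (x k - x s) != 0.
  apply/prodf_neq0 => s sk; rewrite subr_eq0; apply: contra sk => /eqP/x_inj ->.
  by rewrite eqxx.
have Lk k : (L k).[x k] = \prod_(s | s != k) (x k - x s).
  by rewrite horner_prod; apply: eq_bigr => s _; rewrite !hornerE.
have L0 k j : j != k -> (L k).[x j] = 0.
  by move=> jk; rewrite horner_prod (bigD1 j) //= !hornerE subrr mul0r.
have Ep : p = \sum_k (p.[x k] / \prod_(s | s != k) (x k - x s)) *: L k.
  apply: (poly_eq_on_points x_inj).
    rewrite (leq_trans (size_polyD _ _)) // size_polyN geq_max szp /=.
    apply: (leq_trans (size_sum _ _ _)).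
    apply/bigmax_leqP => k _.
    by rewrite (leq_trans (size_scale_leq _ _)) // sL.
  move=> j; rewrite horner_sum (bigD1 j) //= [X in _ + X]big1 ?addr0.
    by rewrite hornerZ Lk mulfVK.
  by move=> k kj; rewrite hornerZ L0 ?mulr0 // eq_sym.
rewrite [in RHS]Ep coef_sum; apply: eq_bigr => k _.
rewrite coefZ; have /monicP := mL k; rewrite /lead_coef sL /= => ->.
by rewrite mulr1.
Qed.

(** Here ['X] is the generating variable z, not the eigenvalue. With a + b fixed, the coefficient of
    index m is the binary Krawtchouk polynomial of degree m in a. *)
Definition krawtchouk a b : {poly R} := (1 - 'X) ^+ a * (1 + 'X) ^+ b.

(** The logarithmic derivative is b / (1 + z) - a / (1 - z); multiplying by 1 - z^2 clears the
    denominators. *)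
Lemma deriv_krawtchouk a b :
  (1 - 'X ^+ 2) * (krawtchouk a b)^`() =
  ((b%:R - a%:R)%:P - (a + b)%:R%:P * 'X) * krawtchouk a b.
Proof.
have eX (u : {poly R}) c : u * (u ^+ c.-1 *+ c) = c%:R * u ^+ c.
  by case: c => [|c]; rewrite ?mulr0n ?mulr0 ?mul0r // mulrnAr -exprS mulr_natl.
rewrite /krawtchouk derivM !deriv_exp !poly.derivE sub0r add0r mulN1r mul1r mulNrn.
set u := 1 - 'X; set v := 1 + 'X.
have -> : 1 - 'X ^+ 2 = u * v by rewrite /u /v; ring.
transitivity (u ^+ a * (u * (v * (v ^+ b.-1 *+ b)))
              - v ^+ b * (v * (u * (u ^+ a.-1 *+ a)))).
  by ring.
rewrite !eX polyCB !polyC_natr natrD /u /v.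
move: (_ ^+ a) (_ ^+ b) => A B; ring.
Qed.

Lemma coef_krawtchouk0 a b : (krawtchouk a b)`_0 = 1.
Proof. by rewrite -horner_coef0 /krawtchouk !hornerE ?subr0 ?addr0 !expr1n ?mulr1. Qed.

Lemma coef_krawtchouk1 a b : (krawtchouk a b)`_1 = b%:R - a%:R.
Proof.
have /(congr1 (fun p : {poly R} => p`_0)) := deriv_krawtchouk a b.
rewrite mulrBl mul1r mulrBl !coefB coefXnM -mulrA !coefCM coefXM coef_deriv /=.
by rewrite coef_krawtchouk0 mulr0 !subr0 mulr1.
Qed.

(** Coefficient of degree m + 1 in the differential equation [deriv_krawtchouk]. *)
Lemma coef_krawtchouk_rec a b m :
  m.+2%:R * (krawtchouk a b)`_m.+2 =
  (b%:R - a%:R) * (krawtchouk a b)`_m.+1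
  - ((a + b)%:R - m%:R) * (krawtchouk a b)`_m.
Proof.
have /(congr1 (fun p : {poly R} => p`_m.+1)) := deriv_krawtchouk a b.
rewrite mulrBl mul1r mulrBl !coefB coefXnM -mulrA !coefCM coefXM !coef_deriv.
case: m => [|m]; rewrite /= ?subSS ?subn0 => e.
  by rewrite mulr_natl mulr0n subr0 -e; rewrite ?mulr0n ?subr0.
move/eqP: e; rewrite subr_eq => /eqP e.
by rewrite mulr_natl e natrD -[_ *+ m.+1]mulr_natl; ring.
Qed.

(** Coefficient form of z^n p(1/z) = e p(z), where n is a formal degree that may exceed the actual
    one. *)
Definition palindromic n (e : R) p : Prop :=
  (size p <= n.+1)%N /\ forall m, (m <= n)%N -> p`_(n - m) = e * p`_m.

(** Since s^2 = 1, z (1 + s/z) = s (1 + s z): the new linear factor is itself palindromic with sign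
    s, and signs multiply. *)
Lemma palindromicM n (e s : R) p : s ^+ 2 = 1 ->
  palindromic n e p -> palindromic n.+1 (e * s) (p * (1 + s *: 'X)).
Proof.
move=> s2 [szp symp].
have E m : (p * (1 + s *: 'X))`_m = p`_m + s * (if m == 0%N then 0 else p`_m.-1).
  by rewrite mulrDr mulr1 -scalerAr coefD coefZ coefMX.
have pn : p`_n.+1 = 0 by apply/(leq_sizeP _ _ szp).
split.
  apply/leq_sizeP => -[|j] // nj; rewrite E /= (leq_sizeP _ _ szp) ?(ltnW nj) //.
  by rewrite (leq_sizeP _ _ szp) // mulr0 addr0.
move=> [|m] mn; rewrite !E ?subn0 ?subSS /=.
  by rewrite pn -{1}(subn0 n) symp //; ring.
rewrite subn_eq0; move: mn; rewrite ltnS leq_eqVlt => /predU1P[->|mn].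
  rewrite leqnn subnn pn -{1}(subnn n) symp // mulr0 addr0 add0r.
  by rewrite mulrA -(mulrA e) -expr2 s2 mulr1.
rewrite leqNgt mn /= symp ?(ltnW mn) // -subnS symp //.
transitivity (e * s * p`_m.+1 + e * s ^+ 2 * p`_m); last by ring.
by rewrite s2; ring.
Qed.

Lemma palindromic_krawtchouk a b : palindromic (a + b) ((-1) ^+ a) (krawtchouk a b).
Proof.
elim: a => [|a IHa].
  rewrite /krawtchouk !expr0 mul1r add0n; elim: b => [|b IHb].
    by rewrite expr0; split=> [|[]//]; rewrite ?size_poly1 // mul1r.
  have := palindromicM (expr1n R 2) IHb.
  by rewrite scale1r mulr1 -exprSr.
have := palindromicM (s := -1) _ IHa.
rewrite sqrrN expr1n scaleN1r -exprSr addSn => /(_ erefl).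
by rewrite {2}/krawtchouk mulrAC -exprSr.
Qed.

Lemma coef_krawtchouk_sym a b m : (m <= a + b)%N ->
  (krawtchouk a b)`_(a + b - m) = (-1) ^+ a * (krawtchouk a b)`_m.
Proof. by case: (palindromic_krawtchouk a b) => _; apply. Qed.

(* The eigenvector equation at x = 'X, with denominators cleared and m = N - k
   where k is the number of particles. *)
Fixpoint ehrenfest_poly N mu m : {poly R} :=
  match m with
  | 0 => 1
  | m1.+1 =>
    let q := ('X + (2 * N%:R * mu)%:P) * ehrenfest_poly N mu m1 in
    if m1 is m2.+1 then
      q - (m1%:R * (2 * N%:R - m2%:R) * mu ^+ 2) *: ehrenfest_poly N mu m2
    else q
  end.

Lemma ehrenfest_polySS N mu m :
  ehrenfest_poly N mu m.+2 = ('X + (2 * N%:R * mu)%:P) * ehrenfest_poly N mu m.+1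
    - (m.+1%:R * (2 * N%:R - m%:R) * mu ^+ 2) *: ehrenfest_poly N mu m.
Proof. by []. Qed.

(** For x = - 2 mu y, a = y and b = 2N - y one has x + 2 N mu = mu (b - a), so after scaling by m!
    mu^m the Krawtchouk recurrence becomes the recurrence that defines [ehrenfest_poly]. *)
Lemma horner_ehrenfest_poly N mu y m : (y <= 2 * N)%N ->
  (ehrenfest_poly N mu m).[- (2 * mu * y%:R)] =
  m`!%:R * mu ^+ m * (krawtchouk y (2 * N - y))`_m.
Proof.
move=> yN.
have eN : (2 * N - y)%:R = 2 * N%:R - y%:R :> R by rewrite natrB // natrM.
elim/ltn_ind: m => -[|[|m]] IHm.
- by rewrite coef_krawtchouk0 expr0 !hornerE.
- by rewrite coef_krawtchouk1 eN /= !hornerE; ring.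
rewrite ehrenfest_polySS hornerD hornerN hornerM hornerZ hornerD hornerX hornerC.
rewrite !IHm // [m.+2`!]factS natrM.
have e := coef_krawtchouk_rec y (2 * N - y) m.
rewrite subnKC // eN natrM in e.
transitivity (m.+1`!%:R * mu ^+ m.+2 *
  (m.+2%:R * (krawtchouk y (2 * N - y))`_m.+2)); last first.
  by move: (m.+1`!%:R : R) (mu ^+ m.+2) (m.+2%:R : R) => A B D; ring.
rewrite e factS natrM [mu ^+ m.+2]exprS [mu ^+ m.+1]exprS.
by move: (m`!%:R : R) (mu ^+ m) (m.+1%:R : R) => A B D; ring.
Qed.

Lemma ehrenfest_poly_monic N mu m :
  ehrenfest_poly N mu m \is monic /\ size (ehrenfest_poly N mu m) = m.+1.
Proof.
elim/ltn_ind: m => -[|[|m]] IHm.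
- by rewrite monic1 size_poly1.
- by rewrite /= mulr1 monicXaddC size_XaddC.
have [m1 s1] := IHm m.+1 (leqnn _).
have [_ s0] := IHm m (leqnSn _).
have mX := monicXaddC (2 * N%:R * mu).
have sM : size (('X + (2 * N%:R * mu)%:P) * ehrenfest_poly N mu m.+1) = m.+3.
  by rewrite size_Mmonic ?monic_neq0 // s1 size_XaddC.
have sS c : (size (- (c *: ehrenfest_poly N mu m)) < m.+3)%N.
  by rewrite size_polyN (leq_ltn_trans (size_scale_leq _ _)) // s0 ltnS leqnSn.
rewrite ehrenfest_polySS size_polyDl ?sM //; split=> //.
apply/monicP; rewrite lead_coefDl ?sM //; apply/monicP.
exact: rpredM.
Qed.

Lemma prod_shift_monic n (c : nat -> R) :
  \prod_(r < n) ('X + (c r)%:P) \is monic /\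
  size (\prod_(r < n) ('X + (c r)%:P)) = n.+1.
Proof.
have e : \prod_(r < n) ('X + (c r)%:P) = \prod_(r < n) ('X - (- c r)%:P).
  by apply: eq_bigr => r _; rewrite polyCN opprK.
by rewrite e monic_prod_XsubC size_prod_XsubC /index_enum -enumT size_enum_ord.
Qed.

Lemma ehrenfest_Q_monic N mu :
  ehrenfest_Q N mu \is monic /\ size (ehrenfest_Q N mu) = N.+1.
Proof. exact: (prod_shift_monic N (fun r => 2 * mu * (2 * r%:R + 1))). Qed.

(* At x = - 2 mu y with y odd, the palindromic symmetry has sign -1, so the
   middle coefficient vanishes. *)
Lemma ehrenfest_poly_middle N mu : 0 < mu ->
  ehrenfest_poly N mu N = ehrenfest_Q N mu.
Proof.
move=> mu0.
have [mG sG] := ehrenfest_poly_monic N mu N.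
have [mQ sQ] := ehrenfest_Q_monic N mu.
(* The odd integers y = 1, 3, ..., 2N - 1 give N points, enough for two monic polynomials of degree
   N. *)
apply: (@poly_eq_on_points N _ _ (fun i => - (2 * mu * (2 * i + 1)%:R))).
- move=> i j /oppr_inj/mulfI; rewrite mulf_neq0 ?pnatr_eq0 ?gt_eqF //.
  by move=> /(_ isT)/eqP; rewrite eqr_nat => /eqP ij; apply: val_inj => /=; lia.
- exact: size_sub_monic.
move=> i.
have iN : (2 * i + 1 <= 2 * N)%N by have := ltn_ord i; lia.
rewrite horner_ehrenfest_poly // /ehrenfest_Q horner_prod (bigD1 i) //=.
rewrite [X in _ = X * _](_ : _ = 0) ?mul0r; last first.
  by rewrite !hornerE natrD natrM; ring.
have := @coef_krawtchouk_sym (2 * i + 1) (2 * N - (2 * i + 1)) N.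
rewrite subnKC // mul2n -addnn leq_addr addnK => /(_ isT).
rewrite -signr_odd oddD addnn -!mul2n oddM /= expr1 => e.
by rewrite (_ : _`_N = 0) ?mulr0 //; lra.
Qed.

(* At x = - 2 mu y with y even, the symmetry exchanges the coefficients of
   index N - 1 and N + 1. *)
Lemma ehrenfest_poly_boundary N mu : 0 < mu ->
  2 *: (ehrenfest_poly N mu N.+1 - (mu * N%:R) *: ehrenfest_poly N mu N) =
  ehrenfest_P N mu.
Proof.
move=> mu0.
have [mG sG] := ehrenfest_poly_monic N mu N.+1.
have [mQ sQ] := ehrenfest_Q_monic N mu.
have [mB sB] := prod_shift_monic N (fun r => 2 * mu * (2 * r%:R + 2)).
set B := \prod_(r < N) _ in mB sB.
have PE : ehrenfest_P N mu = 'X * (ehrenfest_Q N mu + B) by [].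
rewrite ehrenfest_poly_middle //.
suff e : ehrenfest_poly N mu N.+1 = (mu * N%:R) *: ehrenfest_Q N mu
    + 2^-1 *: ehrenfest_P N mu.
  by rewrite e addrC addKr scalerA divff ?scale1r // pnatr_eq0.
(* The even integers y = 0, 2, ..., 2N give N + 1 points. *)
apply: (@poly_eq_on_points N.+1 _ _ (fun i => - (2 * mu * (2 * i)%:R))).
- move=> i j /oppr_inj/mulfI; rewrite mulf_neq0 ?pnatr_eq0 ?gt_eqF //.
  by move=> /(_ isT)/eqP; rewrite eqr_nat => /eqP ij; apply: val_inj => /=; lia.
- have sXM (p : {poly R}) : p \is monic -> size p = N.+1 ->
      (size (ehrenfest_poly N mu N.+1 - 'X * p)%R <= N.+1)%N.
    move=> mp sp; apply: size_sub_monic => //; first by rewrite rpredM ?monicX.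
    by rewrite mulrC size_mulX ?monic_neq0 // sp.
  have h : 2^-1%:P * 2%:R = 1 :> {poly R}.
    by rewrite -polyC_natr -polyCM mulVf ?pnatr_eq0.
  (* The difference is split so that half of the monic polynomial of degree N + 1 cancels against
     each of the two halves of P. *)
  have -> : ehrenfest_poly N mu N.+1 -
      ((mu * N%:R) *: ehrenfest_Q N mu + 2^-1 *: ehrenfest_P N mu) =
      2^-1 *: (ehrenfest_poly N mu N.+1 - 'X * ehrenfest_Q N mu)
      + 2^-1 *: (ehrenfest_poly N mu N.+1 - 'X * B)
      - (mu * N%:R) *: ehrenfest_Q N mu.
    rewrite PE -!mul_polyC -[X in X - _ = _]mul1r -h; ring.
  rewrite (leq_trans (size_polyD _ _)) // geq_max size_polyN.
  rewrite (leq_trans (size_polyD _ _)) ?geq_max /=.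
    by rewrite (leq_trans (size_scale_leq _ _)) // sQ.
  by rewrite !(leq_trans (size_scale_leq _ _)) // sXM.
move=> i.
have iN : (2 * i <= 2 * N)%N by have := ltn_ord i; lia.
set x := - _.
(* The second product [B] vanishes at y = 2i for i >= 1, through its factor of index r = i - 1; at y
   = 0 the factor ['X] of P vanishes instead. *)
have PX : (ehrenfest_P N mu).[x] = x * (ehrenfest_Q N mu).[x].
  rewrite PE !hornerE; have [i0|i0] := eqVneq (i : nat) 0%N.
    by rewrite /x i0 muln0 mulr0 oppr0 !mul0r.
  have iN' : (i.-1 < N)%N by have := ltn_ord i; lia.
  have -> : B.[x] = 0; last by rewrite addr0.
  rewrite /B horner_prod (bigD1 (Ordinal iN')) //= hornerD hornerX hornerC /x.
  rewrite -[X in (2 * X)%:R]prednK ?lt0n // natrM -natr1.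
  by rewrite [X in X * _](_ : _ = 0) ?mul0r //; ring.
suff e : 2 * (ehrenfest_poly N mu N.+1).[x] =
    (x + 2 * N%:R * mu) * (ehrenfest_Q N mu).[x].
  rewrite hornerD !hornerZ PX; lra.
rewrite -ehrenfest_poly_middle //.
clear PX mG sG mQ sQ mB sB PE B; case: N i iN @x => [|N] i iN x.
  have -> : x = 0 by rewrite /x (ord1 i) muln0 mulr0 oppr0.
  by rewrite [ehrenfest_poly 0 mu 1]/= mulr1 hornerD hornerX hornerC; ring.
rewrite ehrenfest_polySS hornerD hornerN hornerM hornerZ hornerD hornerX hornerC.
(* After the shift of N, the indices N and N + 2 are the neighbours of the middle index N + 1, and
   the sign is + because y is even. *)
have := @coef_krawtchouk_sym (2 * i) (2 * N.+1 - (2 * i)) N.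
rewrite subnKC // (_ : 2 * N.+1 - N = N.+2)%N; last by lia.
rewrite -signr_odd oddM /= mul1r => /(_ ltac:(lia)) e.
have e1 := horner_ehrenfest_poly mu N.+2 iN.
have e2 := horner_ehrenfest_poly mu N iN.
rewrite ehrenfest_polySS hornerD hornerN hornerM hornerZ hornerD hornerX hornerC -/x in e1.
rewrite -/x in e2.
(* As 2 (N + 1) - N = N + 2, the term subtracted in the recurrence is itself the value at index N +
   2. That value is therefore half of the remaining product. *)
have e3 : N.+2`!%:R * mu ^+ N.+2 * (krawtchouk (2 * i) (2 * N.+1 - 2 * i))`_N.+2
  = N.+1%:R * (2 * N.+1%:R - N%:R) * mu ^+ 2 * (ehrenfest_poly N.+1 mu N).[x].
  rewrite e2 e [N.+2`!]factS [N.+1`!]factS !natrM [mu ^+ N.+2]exprS [mu ^+ N.+1]exprS.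
  rewrite -[N.+2%:R]natr1 -[N.+1%:R]natr1.
  by move: (N`!%:R : R) (mu ^+ N) => A0 B0; ring.
by rewrite e3 in e1; lra.
Qed.
End Polynomials.

Lemma cvg_sumr {R : realType} {T I : Type} (F : set_system T) (r : seq I)
    (P : pred I) (f : I -> T -> R) (l : I -> R) : Filter F ->
  (forall i, P i -> f i x @[x --> F] --> l i) ->
  \sum_(i <- r | P i) f i x @[x --> F] --> \sum_(i <- r | P i) l i.
Proof. by move=> FF; apply: cvg_big => //; exact: add_continuous. Qed.

(** * Evolution of eigenfunctions under a transition function *)

Section Eigenfunction.
Context {R : realType} {S : finType}.
Implicit Types (p : R -> S -> S -> R) (q : S -> S -> R) (F : S -> R).

(* Subadditive in t up to sup norms, because [p s] is a contraction and
   [expR (a * t) <= 1]; being o(t) at 0, it vanishes. *)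
Let defect p F (a t : R) i := \sum_j p t i j * F j - expR (a * t) * F i.

Let defectD p F (a s t : R) i : transition_function p -> 0 <= s -> 0 <= t ->
  defect p F a (s + t) i =
  \sum_k p s i k * defect p F a t k + expR (a * t) * defect p F a s i.
Proof.
case=> _ _ _ ck s0 t0; rewrite /defect mulrBr.
have -> : \sum_j p (s + t) i j * F j = \sum_k p s i k * \sum_j p t k j * F j.
  under eq_bigr do rewrite ck // mulr_suml.
  rewrite exchange_big /=; apply: eq_bigr => k _.
  by rewrite mulr_sumr; apply: eq_bigr => j _; rewrite mulrA.
have -> : \sum_k p s i k * (\sum_j p t k j * F j - expR (a * t) * F k) =
    \sum_k p s i k * (\sum_j p t k j * F j)
    - expR (a * t) * \sum_j p s i j * F j.
  rewrite mulr_sumr -sumrB; apply: eq_bigr => k _.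
  by rewrite mulrBr [_ * (_ * F k)]mulrCA.
by rewrite mulrDr expRD; ring.
Qed.

Let defect_le p F (a h M : R) n i : transition_function p -> a <= 0 -> 0 <= h ->
  (forall j, `|defect p F a h j| <= M) -> `|defect p F a (h *+ n) i| <= M *+ n.
Proof.
move=> tp a0 h0 hM; elim: n i => [|n IHn] i.
  have [_ _ p0 _] := tp.
  rewrite /defect !mulr0n mulr0 expR0 mul1r (bigD1 i) //= p0 eqxx mul1r.
  by rewrite big1 ?addr0 ?subrr ?normr0 // => j ij; rewrite p0 eq_sym (negbTE ij) mul0r.
rewrite mulrS defectD ?mulrn_wge0 // mulrSr (le_trans (ler_normD _ _)) // lerD //.
  have [p0 p1 _ _] := tp.
  rewrite -[leRHS]mul1r -(p1 h i h0) mulr_suml (le_trans (ler_norm_sum _ _ _)) //.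
  by apply: ler_sum => k _; rewrite normrM ger0_norm ?p0 // ler_wpM2l ?p0.
rewrite normrM ger0_norm ?expR_ge0 // -[leRHS]mul1r ler_pM ?expR_ge0 //.
by rewrite expR_le1 mulr_le0_ge0 // mulrn_wge0.
Qed.

(** Row sums equal to 1 turn the diagonal term into differences F j - F i, so that only off-diagonal
    rates enter; the limit is then the eigenvalue equation minus the derivative of the exponential
    at 0. *)
Let cvg_defect p q F (a : R) i : transition_function p -> has_rates p q ->
  \sum_j q i j * (F j - F i) = a * F i ->
  defect p F a h i / h @[h --> 0^'+] --> 0.
Proof.
move=> [_ p1 _ _] pq eigF.
(* The last quotient is spelled as in the definition of the directional derivative at 0 in direction
   1. *)
pose g h :=  \sum_(j | j != i) p h i j / h * (F j - F i)
     - (h^-1 *: (expR (a * (h *: 1 + 0)) - expR (a * 0))) * F i.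
have e : {near 0^'+, g =1 (fun h => defect p F a h i / h)}.
  near=> h; have h0 : 0 <= h by near: h; exact: nbhs_right_ge.
  rewrite /g /defect mulr0 expR0 addr0 /GRing.scale /= mulr1.
  have -> : \sum_j p h i j * F j =
      \sum_(j | j != i) p h i j * (F j - F i) + F i.
    rewrite -[F i in X in _ = _ + X]mul1r -(p1 h i h0) mulr_suml.
    rewrite [in LHS](bigD1 i) //= [X in _ = _ + X](bigD1 i) //= addrCA -big_split /=.
    by congr (_ + _); apply: eq_bigr => j _; ring.
  rewrite mulrBl mulrDl mulr_suml.
  under eq_bigr do rewrite mulrAC.
  ring.
apply: cvg_trans (near_eq_cvg e) _.
have z : \sum_(j | j != i) q i j * (F j - F i) - a * F i = 0.
  by rewrite -eigF [X in _ - X](bigD1 i) //= subrr mulr0 add0r subrr.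
suff cg : g h @[h --> 0^'+] --> \sum_(j | j != i) q i j * (F j - F i) - a * F i.
  by rewrite z in cg.
apply: cvgB.
  apply: cvg_sumr => j ji; apply: cvgMr_tmp; apply: pq; by rewrite eq_sym.
apply: cvgMr_tmp; apply: cvg_dnbhs_at_right.
have dexp : is_derive (0 : R) (1 : R) (fun x : R => expR (a * x)) a.
  have d1 : is_derive (0 : R) (1 : R) (fun x => a *: x) (a *: 1) by exact: is_deriveZ.
  have := @is_derive1_comp R expR (fun x => a *: x) 0 _ _ (is_derive_expR _) d1.
  by rewrite scaler0 expR0 mul1r /GRing.scale /= mulr1.
have := @ex_derive _ _ _ _ _ _ _ dexp.
rewrite -[X in _ --> X](@derive_val _ _ _ _ _ _ _ dexp).
exact.
Unshelve. all: by end_near. Qed.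

(** Cutting [0, t] into n steps of length h bounds the defect at t by n times a bound on the defect
    at h, that is by t times a quantity that tends to 0 with h. *)
Lemma transition_eigenfunction p q F (a : R) :
  transition_function p -> has_rates p q -> a <= 0 ->
  (forall i, \sum_j q i j * (F j - F i) = a * F i) ->
  forall t i, 0 <= t -> \sum_j p t i j * F j = expR (a * t) * F i.
Proof.
move=> tp pq a0 eigF t i; rewrite le_eqVlt => /predU1P[<-|t0].
  have [_ _ p0 _] := tp.
  rewrite mulr0 expR0 mul1r (bigD1 i) //= p0 eqxx mul1r.
  by rewrite big1 ?addr0 // => j ij; rewrite p0 eq_sym (negbTE ij) mul0r.
apply/eqP; rewrite -subr_eq0 -/(defect p F a t i) -normr_le0.
apply/ler_addgt0Pr => e e0; rewrite add0r.
(* Summing over the finitely many states provides one h that works for all starting states, as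
   [defect_le] requires. *)
have : \sum_j `|defect p F a h j / h| @[h --> 0^'+] --> \sum_(j : S) `|0 : R|.
  by apply: cvg_sumr => j _; apply: cvg_norm; exact: cvg_defect (eigF j).
rewrite normr0 big1_eq.
move=> /cvgrPdist_lt/(_ (e / t)); rewrite divr_gt0 // => /(_ isT).
rewrite near_withinE => -[d /= d0 dP].
have [n nd] : exists n, t / n.+1%:R < d.
  exists (Num.truncn (t / d)); rewrite ltr_pdivrMr // mulrC -ltr_pdivrMr //.
  exact: Num.Theory.truncnS_gt.
have h0 : 0 < t / n.+1%:R by rewrite divr_gt0.
have := dP (t / n.+1%:R); rewrite /= sub0r normrN gtr0_norm // => /(_ nd h0).
rewrite sub0r normrN ger0_norm ?sumr_ge0 //.
under eq_bigr do rewrite normrM normfV (gtr0_norm h0).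
rewrite -mulr_suml ltr_pdivrMr // => /ltW He.
have et : (t / n.+1%:R) *+ n.+1 = t by rewrite -mulr_natr divfK.
rewrite -[in leLHS]et.
apply: le_trans (defect_le (M := e / t * (t / n.+1%:R)) _ _ tp a0 (ltW h0) _) _.
  by move=> j; apply: le_trans He; rewrite (bigD1 j) //= lerDl sumr_ge0 //.
by rewrite -mulrnAr et divfK // gt_eqF.
Qed.
End Eigenfunction.

(** * The Gamma function at half-integers, by Gaussian moments *)

Section GammaHalfInteger.
Context {R : realType}.
Local Notation mu := (@lebesgue_measure R).
Implicit Types (n k : nat) (x y : R).

Let moment k y : R := y ^+ k * gauss_fun y.

Let moment_ge0 k y : ~~ odd k -> 0 <= moment k y.
Proof. by move=> ok; rewrite mulr_ge0 ?gauss_fun_ge0 // exprn_even_ge0. Qed.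

Let continuous_moment k : continuous (moment k).
Proof.
move=> y; apply: cvgM; first exact: exprn_continuous.
exact: continuous_gauss_fun.
Qed.

Let measurable_moment k : measurable_fun setT (moment k).
Proof. apply: measurable_funM; [exact: measurable_funX|exact: measurable_gauss_fun]. Qed.

(** The exponential series gives exp(y^2) >= y^(2k+2) / (k+1)!, hence y^k exp(- y^2) <= (k+1)! / y
    for y >= 1. *)
Let cvg_moment k : moment k n.+1%:R @[n --> \oo] --> (0 : R).
Proof.
apply: (squeeze_cvgr (f := fun=> 0) (h := fun n => k.+1`!%:R * harmonic n)).
- apply: nearW => n; set y : R := n.+1%:R.
  have y1 : 1 <= y by rewrite ler1n.
  have y0 : 0 < y by rewrite ltr0n.
  rewrite mulr_ge0 ?exprn_ge0 ?(ltW y0) ?gauss_fun_ge0 //=.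
  rewrite /moment /gauss_fun expRN ler_pdivrMr ?expR_gt0 //.
  have := expR_ge1Dxn k (sqr_ge0 y); rewrite -exprM => h.
  have {h} h : y ^+ (2 * k.+1) <= k.+1`!%:R * expR (y ^+ 2).
    rewrite mulrC -ler_pdivrMr ?ltr0n ?fact_gt0 //.
    by apply: le_trans h; rewrite lerDr.
  rewrite mulrAC ler_pdivlMr // (le_trans _ h) // -exprSr ler_weXn2l //; lia.
- exact: cvg_cst.
- rewrite -[X in _ --> X](mulr0 (k.+1`!%:R : R)).
  by apply: cvgMl_tmp; exact: cvg_harmonic.
Qed.

Let is_derive_gauss y : is_derive y 1 (fun x => - 2^-1 * gauss_fun x) (y * gauss_fun y).
Proof.
have d2 : is_derive y 1 (fun x : R => - x ^+ 2) (- (y *+ 2)).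
  apply: is_deriveN; apply: is_derive_eq.
  by rewrite /GRing.scale /= mulr1 mulr2n.
have d3 := @is_derive1_comp R expR (fun x => - x ^+ 2) y _ _ (is_derive_expR _) d2.
have d4 := is_deriveZ (- 2^-1) d3.
apply: (is_derive_eq d4).
by rewrite /GRing.scale /= /gauss_fun; field.
Qed.

(** The factor y exp(- y^2) is integrated to - exp(- y^2) / 2; the boundary term at 0 vanishes
    because y^(k+1) does. *)
Let moment_by_parts k (b : R) : 0 < b ->
  (\int[mu]_(y in `[0%R, b]) (moment k.+2 y)%:E =
   (- 2^-1 * moment k.+1 b)%:E +
   (k.+1%:R / 2)%:E * \int[mu]_(y in `[0%R, b]) (moment k y)%:E)%E.
Proof.
move=> b0.
have := @integration_by_parts R (fun y => y ^+ k.+1)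
  (fun y => - 2^-1 * gauss_fun y) (fun y => k.+1%:R * y ^+ k)
  (fun y => y * gauss_fun y) 0 b b0.
have dX y : is_derive y 1 (fun x : R => x ^+ k.+1) (k.+1%:R * y ^+ k).
  have := is_deriveX k.+1 (is_derive_id y 1).
  have -> : (id : R -> R) ^+ k.+1 = (fun x => x ^+ k.+1).
    by apply/funext => x; rewrite exprfctE.
  by rewrite /GRing.scale /= mulr1.
have cX m (c : R) : continuous (fun x : R => c * x ^+ m).
  by move=> y; apply: cvgMl_tmp; exact: exprn_continuous.
have cG : continuous (fun y => - 2^-1 * gauss_fun y : R).
  by move=> y; apply: cvgMl_tmp; exact: continuous_gauss_fun.
rewrite (_ : (fun y => (y ^+ k.+1 * (y * gauss_fun y))%:E) =
             (fun y => (moment k.+2 y)%:E)); last first.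
  by apply/funext => y; rewrite mulrA -exprSr.
rewrite (_ : (fun y => (k.+1%:R * y ^+ k * (- 2^-1 * gauss_fun y))%:E) =
             (fun y => ((- (k.+1%:R / 2))%:E * (moment k y)%:E)%E)); last first.
  by apply/funext => y; rewrite -EFinM /moment; congr EFin; ring.
move=> ->.
- rewrite integralZl //; last first.
    apply: continuous_compact_integrable; first exact: segment_compact.
    by apply: continuous_subspaceT; exact: continuous_moment.
  rewrite expr0n mul0r subr0 EFinN mulNe oppeK /moment.
  by congr (_%:E + _)%E; ring.
- by apply: continuous_subspaceT; exact: cX.
- split.
  + by move=> y _; exact: (@ex_derive _ _ _ _ _ _ _ (dX y)).
  + by apply: cvg_at_right_filter; exact: exprn_continuous.
  + by apply: cvg_at_left_filter; exact: exprn_continuous.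
- by move=> y _; rewrite derive1E; exact: (@derive_val _ _ _ _ _ _ _ (dX y)).
- apply: continuous_subspaceT => y.
  by apply: cvgM; [exact: cvg_id | exact: continuous_gauss_fun].
- split.
  + by move=> y _; exact: (@ex_derive _ _ _ _ _ _ _ (is_derive_gauss y)).
  + by apply: cvg_at_right_filter; exact: cG.
  + by apply: cvg_at_left_filter; exact: cG.
- by move=> y _; rewrite derive1E; exact: (@derive_val _ _ _ _ _ _ _ (is_derive_gauss y)).
Qed.

Let integral_moment n :
  (\int[mu]_(y in `[0%R, +oo[) (moment (2 * n) y)%:E =
   (\prod_(i < n) (i%:R + 2^-1) * (Num.sqrt pi / 2))%:E)%E.
Proof.
elim: n => [|n IHn].
  rewrite big_ord0 mul1r -integral0y_gauss muln0.
  by apply: eq_integral => y _; rewrite /moment expr0 mul1r.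
have e2 : (2 * n.+1)%N = (2 * n).+2 by lia.
(* Integration by parts passes to the limit along b = i + 1, which keeps b positive; each step
   contributes the factor (2n + 1) / 2 = n + 1/2. *)
have cS : (\int[mu]_(y in `[0%R, i.+1%:R]) (moment (2 * n.+1) y)%:E @[i --> \oo] -->
    \int[mu]_(y in `[0%R, +oo[) (moment (2 * n.+1) y)%:E)%E.
  rewrite (cvg_shiftS (fun i => \int[mu]_(y in `[0%R, i%:R]) (moment (2 * n.+1) y)%:E)%E).
  by apply: ge0_cvgn_integral => // y; rewrite moment_ge0 // oddM.
have c : (\int[mu]_(y in `[0%R, i.+1%:R]) (moment (2 * n) y)%:E @[i --> \oo] -->
    \int[mu]_(y in `[0%R, +oo[) (moment (2 * n) y)%:E)%E.
  rewrite (cvg_shiftS (fun i => \int[mu]_(y in `[0%R, i%:R]) (moment (2 * n) y)%:E)%E).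
  by apply: ge0_cvgn_integral => // y; rewrite moment_ge0 // oddM.
have cb : ((- 2^-1 * moment (2 * n).+1 i.+1%:R)%:E @[i --> \oo] --> (0 : R)%:E)%E.
  apply: cvg_EFin; first exact: nearW.
  rewrite -[X in _ --> X](mulr0 (- 2^-1)).
  by apply: cvgMl_tmp; exact: cvg_moment.
rewrite IHn in c.
have c2 := cvgeZl (y := ((2 * n).+1%:R / 2)%:E) isT c.
have := cvgeD _ cb c2; rewrite -EFinM => /(_ _ isT) cD.
have -> : (\int[mu]_(y in `[0%R, +oo[) (moment (2 * n.+1) y)%:E)%E =
    (0%:E + ((2 * n).+1%:R / 2 * (\prod_(i < n) (i%:R + 2^-1) * (Num.sqrt pi / 2)))%:E)%E.
  apply: (cvg_unique _ cS); first exact: ereal_hausdorff.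
  apply: cvg_trans cD; apply: near_eq_cvg; apply: nearW => i /=.
  by rewrite e2 moment_by_parts.
rewrite add0e big_ord_recr /=; congr EFin.
by rewrite -natr1 natrM; field.
Qed.

Let gamma_integrand n x : R := x `^ (n%:R + 2^-1 - 1) * expR (- x).

Let measurable_gamma_integrand n : measurable_fun setT (gamma_integrand n).
Proof.
apply: measurable_funM; first exact: measurable_powR.
by apply: measurableT_comp => //; exact: measurable_funN.
Qed.

Let cvg_sqrty : (fun x : R => Num.sqrt x) x @[x --> +oo%R] --> +oo%R.
Proof.
apply/cvgryPge => A; near=> x.
rewrite (le_trans (ler_norm A)) // -sqrtr_sqr ler_sqrt //.
Unshelve. all: by end_near. Qed.

(* The substitution y = sqrt x, away from 0 where sqrt is not differentiable. *)
Let gamma_substitution n (a : R) : 0 < a ->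
  (\int[mu]_(y in `[Num.sqrt a, +oo[) (2 * moment (2 * n) y)%:E =
   \int[mu]_(x in `[a, +oo[) (gamma_integrand n x)%:E)%E.
Proof.
move=> a0.
have dE (x : R) : 0 < x -> derive1 Num.sqrt x = (2 * Num.sqrt x)^-1.
  by move=> x0; rewrite derive1E derive_sqrt.
have cV (x : R) : 0 < x -> (2 * Num.sqrt z)^-1 @[z --> x] --> (2 * Num.sqrt x)^-1.
  move=> x0; apply: cvgV; first by rewrite mulf_neq0 // gt_eqF ?sqrtr_gt0.
  by apply: cvgMl_tmp; exact: sqrt_continuous.
rewrite (@increasing_ge0_integration_by_substitutiony R Num.sqrt
  (fun y => 2 * moment (2 * n) y) a).
- apply: eq_integral => x; rewrite inE /= in_itv /= andbT => ax.
  have x0 := lt_le_trans a0 ax.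
  rewrite mulrfctE /= dE // /gamma_integrand /moment /gauss_fun exprM sqr_sqrtr ?(ltW x0) //.
  congr EFin.
  rewrite -addrA powRD; last by rewrite (gt_eqF x0) implybT.
  rewrite powR_mulrn ?(ltW x0) //.
  rewrite (_ : 2^-1 - 1 = - 2^-1); last by field.
  rewrite powRN powR12_sqrt ?(ltW x0) //.
  have s0 : Num.sqrt x != 0 by rewrite gt_eqF ?sqrtr_gt0.
  by field.
- move=> x y; rewrite !in_itv /= !andbT => ax ay xy.
  by rewrite ltr_sqrt // (lt_le_trans a0).
- move=> x; rewrite in_itv /= andbT => ax.
  have x0 := lt_trans a0 ax.
  rewrite /continuous_at dE //; apply: cvg_trans (cV x x0).
  apply: near_eq_cvg; near=> z; rewrite dE //.
  by near: z; exact: lt_nbhsr.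
- apply/cvg_ex; exists (2 * Num.sqrt a)^-1.
  apply: cvg_trans (cvg_at_right_filter (cV a a0)).
  apply: near_eq_cvg; near=> z; rewrite dE // (lt_trans a0) //.
- apply/cvg_ex; exists 0.
  apply: cvg_trans (_ : (2 * Num.sqrt z)^-1 @[z --> +oo] --> 0).
    apply: near_eq_cvg; near=> z; rewrite dE //.
  have s0 : \forall z \near +oo, 0 < 2 * Num.sqrt z :> R.
    by near=> z; rewrite mulr_gt0 // sqrtr_gt0.
  by apply: (gtr0_cvgV0 s0).2; exact: (gt0_cvgMry (ltr0n R 2) cvg_sqrty).
- split.
    move=> x; rewrite in_itv /= andbT => ax.
    exact: (@ex_derive _ _ _ _ _ _ _ (is_derive1_sqrt (lt_trans a0 ax))).
  by apply: cvg_at_right_filter; exact: sqrt_continuous.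
- exact: cvg_sqrty.
- apply: continuous_subspaceT => y.
  by apply: cvgMl_tmp; exact: continuous_moment.
- by move=> y _; rewrite mulr_ge0 // moment_ge0 // oddM.
Unshelve. all: by end_near. Qed.

(** Monotone convergence along closed rays, the domains on which the substitution is available,
    exhausting the open half-line. *)
Let cvg_integral_itvoy (f : R -> R) (e : R^nat) : measurable_fun setT f ->
  (forall x, 0 < x -> 0 <= f x) -> (forall i, 0 < e i) ->
  {homo e : i j / (i <= j)%N >-> j <= i} -> e i @[i --> \oo] --> (0 : R) ->
  (\int[mu]_(x in `[e i, +oo[) (f x)%:E @[i --> \oo] -->
   \int[mu]_(x in `]0%R, +oo[) (f x)%:E)%E.
Proof.
move=> mf f0 e0 e_decr e_cvg.
have -> : `]0, +oo[%classic = \bigcup_i `[e i, +oo[%classic.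
  apply/seteqP; split=> [x|x [i _]] /=; rewrite !in_itv /= !andbT; last first.
    exact: lt_le_trans.
  move=> x0; have /cvgrPdist_lt/(_ _ x0)[i _ /(_ i (leqnn i))] := e_cvg.
  rewrite /= sub0r normrN gtr0_norm // => ex.
  by exists i => //=; rewrite in_itv /= andbT ltW.
apply: ge0_nondecreasing_set_cvg_integral => //.
- move=> i j ij; rewrite subsetEset; apply: subset_itvr.
  by rewrite bnd_simp e_decr.
- by move=> i; apply/measurable_EFinP; exact: measurable_funTS.
- move=> i x /=; rewrite in_itv /= andbT lee_fin => ex.
  by rewrite f0 // (lt_le_trans _ ex).
Qed.

Lemma Gamma_half n :
  Gamma (n%:R + 2^-1 : R) = \prod_(i < n) (i%:R + 2^-1) * Num.sqrt pi.
Proof.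
have mM : measurable_fun setT (fun y => 2 * moment (2 * n) y).
  by apply: measurable_funM => //; exact: measurable_moment.
have M0 y : 0 < y -> 0 <= 2 * moment (2 * n) y.
  by move=> _; rewrite mulr_ge0 // moment_ge0 // oddM.
have h_decr : {homo @harmonic R : i j / (i <= j)%N >-> j <= i}.
  by move=> i j ij; rewrite /harmonic /= lef_pV2 ?posrE // ler_nat.
have c1 := cvg_integral_itvoy mM M0 (@harmonic_gt0 R) h_decr (@cvg_harmonic R).
(* The cutoffs in x are the squares of the cutoffs in y, so that the truncated integrals agree term
   by term. *)
have c2 : (\int[mu]_(x in `[(harmonic i ^+ 2 : R)%R, +oo[) (gamma_integrand n x)%:E
    @[i --> \oo] --> \int[mu]_(x in `]0%R, +oo[) (gamma_integrand n x)%:E)%E.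
  apply: (cvg_integral_itvoy (e := fun i => harmonic i ^+ 2)).
  - exact: measurable_gamma_integrand.
  - by move=> x _; rewrite mulr_ge0 ?powR_ge0 ?expR_ge0.
  - by move=> i; rewrite exprn_gt0 // harmonic_gt0.
  - by move=> i j ij; rewrite lerXn2r ?nnegrE ?harmonic_ge0 // h_decr.
  - rewrite -[X in _ --> X](mulr0 (0 : R)).
    by apply: cvgM; exact: cvg_harmonic.
have e : (\int[mu]_(x in `]0%R, +oo[) (gamma_integrand n x)%:E =
    \int[mu]_(y in `]0%R, +oo[) (2 * moment (2 * n) y)%:E)%E.
  apply: (cvg_unique _ c2); first exact: ereal_hausdorff.
  apply: cvg_trans c1; apply: near_eq_cvg; apply: nearW => i.
  rewrite /= -gamma_substitution ?exprn_gt0 ?harmonic_gt0 //.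
  by rewrite sqrtr_sqr ger0_norm ?harmonic_ge0.
rewrite /Gamma e.
under eq_integral do rewrite EFinM.
rewrite ge0_integralZl //; last 2 first.
- by apply/measurable_EFinP; apply: measurable_funTS; exact: measurable_moment.
- by move=> y _; rewrite lee_fin moment_ge0 // oddM.
rewrite integral_itv_obnd_cbnd; last first.
  by apply/measurable_EFinP; apply: measurable_funTS; exact: measurable_moment.
rewrite integral_moment -EFinM /=.
by field.
Qed.

End GammaHalfInteger.

(** * Location and simplicity of the roots of P *)

Lemma poly_sign_change {R : rcfType} (p : {poly R}) (a b : R) :
  a <= b -> p.[a] * p.[b] < 0 -> exists2 x, a < x < b & root p x.
Proof.
move=> ab pab.
have [x /andP[ax xb] rx] : exists2 x, a <= x <= b & root p x.
  case/boolP: (p.[a] <= 0) => pa.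
    apply: poly_ivt ab _ => //; rewrite pa /= leNgt; apply/negP => pb.
    by move: pab; rewrite ltNge mulr_le0 // ltW.
  rewrite -ltNge in pa; rewrite pmulr_rlt0 // in pab.
  have [|x axb] := @poly_ivt R (- p) a b ab.
    by rewrite !hornerN oppr_le0 oppr_ge0 !ltW.
  by rewrite rootN; exists x.
exists x => //; rewrite !lt_neqAle ax xb !andbT; apply/andP; split.
  by apply: contraTneq pab => ->; rewrite (rootP rx) mul0r ltxx.
by apply: contraTneq pab => <-; rewrite (rootP rx) mulr0 ltxx.
Qed.

Section Roots.
Context {R : realType}.
Implicit Types (N : nat) (mu : R).

Lemma ehrenfest_P_size N mu : 0 < mu ->
  size (ehrenfest_P N mu) = N.+2 /\ lead_coef (ehrenfest_P N mu) = 2.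
Proof.
move=> mu0; rewrite -ehrenfest_poly_boundary //.
have [mG sG] := ehrenfest_poly_monic N mu N.+1.
have [_ sG'] := ehrenfest_poly_monic N mu N.
set q := - _.
have sq : (size q < size (ehrenfest_poly N mu N.+1))%N.
  by rewrite sG size_polyN (leq_ltn_trans (size_scale_leq _ _)) // sG'.
split; first by rewrite size_scale ?pnatr_eq0 // size_polyDl.
by rewrite lead_coefZ lead_coefDl // (monicP mG) mulr1.
Qed.

Lemma ordered_roots_inj N (p : {poly R}) (alpha : 'I_N.+1 -> R) :
  ordered_roots p alpha -> injective alpha.
Proof.
case=> _ lt_alpha _ i j eij; apply/val_inj/eqP; case: ltngtP => // /lt_alpha.
  by rewrite eij ltxx.
by rewrite eij ltxx.
Qed.

(** P has degree N + 1 and as many distinct roots, hence all are simple; the leading coefficient is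
    2. *)
Lemma ehrenfest_P_factor N mu (alpha : 'I_N.+1 -> R) : 0 < mu ->
  ordered_roots (ehrenfest_P N mu) alpha ->
  ehrenfest_P N mu = 2 *: \prod_i ('X - (alpha i)%:P).
Proof.
move=> mu0 oa; have inj := ordered_roots_inj oa; case: oa => _ _ rootE.
have [sP lP] := ehrenfest_P_size N mu0.
rewrite [LHS](@all_roots_prod_XsubC _ _ [seq alpha i | i <- enum 'I_N.+1]).
- by rewrite lP big_map big_enum.
- by rewrite sP size_map size_enum_ord.
- by apply/allP => _ /mapP[i _ ->]; apply/rootE; exists i.
- by rewrite uniq_rootsE map_inj_uniq ?enum_uniq.
Qed.

(** At each of the two points one of the two products vanishes. Pairing the factors of index s of
    the remaining ones gives (2 mu)^2 (4 (s - r)^2 - 1), which is negative exactly for s = r. *)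
Lemma ehrenfest_P_sign_change N mu (r : 'I_N) : 0 < mu ->
  let S := \prod_(s < N) ('X + (2 * mu * (2 * s%:R + 1))%:P)
        + \prod_(s < N) ('X + (2 * mu * (2 * s%:R + 2))%:P) : {poly R} in
  S.[- (2 * mu * (2 * r%:R + 2))] * S.[- (2 * mu * (2 * r%:R + 1))] < 0.
Proof.
move=> mu0; cbv zeta.
set x := - (2 * mu * (2 * r%:R + 2)); set y := - (2 * mu * (2 * r%:R + 1)).
rewrite !hornerD !horner_prod.
under eq_bigr do rewrite hornerD hornerX hornerC.
under [X in _ + X]eq_bigr do rewrite hornerD hornerX hornerC.
under [X in _ * (X + _)]eq_bigr do rewrite hornerD hornerX hornerC.
under [X in _ * (_ + X)]eq_bigr do rewrite hornerD hornerX hornerC.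
rewrite [X in (_ + X) * _](_ : _ = 0); last first.
  by rewrite (bigD1 r) //= addNr mul0r.
rewrite [X in _ * (X + _)](_ : _ = 0); last first.
  by rewrite (bigD1 r) //= addNr mul0r.
rewrite addr0 add0r -big_split /= (bigD1 r) //=.
rewrite nmulr_rlt0; last first.
  rewrite [X in X < _](_ : _ = - (2 * mu) ^+ 2); last by rewrite /x /y; ring.
  by rewrite oppr_lt0 exprn_gt0 // mulr_gt0.
apply: prodr_gt0 => s sr.
rewrite [X in _ < X](_ : _ =
  (2 * mu) ^+ 2 * (4 * (s%:R - r%:R) ^+ 2 - 1)); last by rewrite /x /y; ring.
rewrite mulr_gt0 ?exprn_gt0 ?mulr_gt0 // subr_gt0.
suff : 1 <= (s%:R - r%:R) ^+ 2 :> R by lra.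
have : (s%:R - r%:R) ^+ 2 = ((s%:Z - r%:Z) ^+ 2)%:~R :> R.
  by rewrite rmorphXn rmorphB.
move=> ->; rewrite ler1z.
have : (s : nat) != r by [].
by move=> ?; nia.
Qed.

(** The sign changes give one root in each of N disjoint intervals of the negative axis; with the
    root 0 this makes N + 1, which exhausts the degree. *)
Lemma ehrenfest_roots_exist N mu : 0 < mu ->
  exists alpha : 'I_N.+1 -> R, ordered_roots (ehrenfest_P N mu) alpha.
Proof.
move=> mu0.
have ex (r : 'I_N) : exists x : R, - (2 * mu * (2 * r%:R + 2)) < x < - (2 * mu * (2 * r%:R + 1))
    /\ root (ehrenfest_P N mu) x.
  have [|x xI rx] := poly_sign_change _ (ehrenfest_P_sign_change r mu0).
    by rewrite lerN2 ler_pM2l ?mulr_gt0 // lerD2l ler1n.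
  by exists x; split=> //; rewrite /ehrenfest_P rootM rx orbT.
pose f (r : 'I_N) : R := projT1 (cid (ex r)).
have fI (r : 'I_N) : - (2 * mu * (2 * r%:R + 2)) < f r < - (2 * mu * (2 * r%:R + 1)).
  by rewrite /f; case: cid => x [].
have fR r : root (ehrenfest_P N mu) (f r).
  by rewrite /f; case: cid => x [].
pose alpha (i : 'I_N.+1) := if unlift ord0 i is Some r then f r else 0.
have alpha0 : alpha ord0 = 0 by rewrite /alpha unlift_none.
have alphaS r : alpha (lift ord0 r) = f r by rewrite /alpha liftK.
have lt_alpha (i j : 'I_N.+1) : (i < j)%N -> alpha j < alpha i.
  case: (unliftP ord0 j) => [s|] -> //; rewrite alphaS => ij.
  have /andP[_ fs] := fI s.
  move: ij; case: (unliftP ord0 i) => [r|] ->.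
    rewrite alphaS !lift0 ltnS => rs; apply: (lt_trans fs).
    have /andP[fr _] := fI r; apply: le_lt_trans fr.
    rewrite lerN2 ler_pM2l ?mulr_gt0 //.
    have : r.+1%:R <= s%:R :> R by rewrite ler_nat.
    by rewrite -natr1; lra.
  by rewrite alpha0 => _; apply: (lt_trans fs); rewrite oppr_lt0 !mulr_gt0 // ltr_wpDl.
have alpha_inj : injective alpha.
  move=> i j eij; apply/val_inj/eqP; case: ltngtP => // /lt_alpha.
    by rewrite eij ltxx.
  by rewrite eij ltxx.
have [sP lP] := ehrenfest_P_size N mu0.
exists alpha; split => // x; split=> [rx|[i ->]]; last first.
  rewrite /alpha; case: unliftP => [r|] _; first exact: fR.
  by rewrite /ehrenfest_P rootM rootX eqxx.
apply/not_existsP => nx.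
have P0 : ehrenfest_P N mu = 0.
  apply: (@roots_geq_poly_eq0 _ _ (x :: [seq alpha i | i <- enum 'I_N.+1])).
  - rewrite /= rx; apply/allP => _ /mapP[i _ ->].
    rewrite /alpha; case: unliftP => [r|] _; first exact: fR.
    by rewrite /ehrenfest_P rootM rootX eqxx.
  - rewrite /= map_inj_uniq ?enum_uniq // andbT.
    by apply/mapP => -[i _ ex']; apply: (nx i).
  - by rewrite sP /= size_map size_enum_ord.
by rewrite P0 size_poly0 in sP.
Qed.

End Roots.

(** * Eigenfunctions of the Ehrenfest generator *)

Section Generator.
Context {R : realType}.
Implicit Types (N d : nat) (mu x : R).

(** Row sums of [C] equal to 1 make the types disappear from the generator on functions of the
    number of particles. At k = 0 the truncated [k.-1] makes the downward difference vanish; at k =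
    N the upward rate is 0. *)
Lemma sum_ehrenfest_rate N d mu (C : 'M[R]_d) (f : nat -> R)
    (k : 'I_N.+1) (j : 'I_d) : stochastic_matrix C ->
  \sum_y ehrenfest_rate mu mu C (k, j) y * (f y.1 - f k) =
  mu * (N%:R + k%:R) * (f k.-1 - f k) + mu * (N%:R - k%:R) * (f k.+1 - f k).
Proof.
move=> [_ C1].
have rowE (k' : 'I_N.+1) : \sum_(j' < d) ehrenfest_rate mu mu C (k, j) (k', j') =
    (if k == k'.+1 :> nat then mu * (N%:R + k%:R) else 0)
    + (if k' == k.+1 :> nat then mu * (N%:R - k%:R) else 0).
  rewrite /ehrenfest_rate; case: (eqVneq (k : nat) k'.+1) => [kk'|kk'] /=.
    have -> : (k' == k.+1 :> nat) = false by apply/eqP; lia.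
    rewrite addr0 (bigD1 j) //= eqxx big1 ?addr0 // => j' j'j.
    by rewrite eq_sym (negbTE j'j).
  rewrite add0r; case: (eqVneq (k' : nat) k.+1) => [k'k|k'k]; last by rewrite big1.
  case: (eqVneq (k : nat) 0%N) => k0.
    by under eq_bigr do rewrite -mulrA; rewrite -mulr_suml C1 k0 subr0 mul1r.
  rewrite (bigD1 j) //= eqxx big1 ?addr0 // => j' j'j.
  by rewrite eq_sym (negbTE j'j).
have -> : \sum_y ehrenfest_rate mu mu C (k, j) y * (f y.1 - f k) =
    \sum_(k' < N.+1) (f k' - f k) * \sum_(j' < d) ehrenfest_rate mu mu C (k, j) (k', j').
  under [RHS]eq_bigr do rewrite mulr_sumr.
  by rewrite pair_big /=; apply: eq_bigr => -[k' j'] _ /=; rewrite mulrC.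
under eq_bigr do rewrite rowE mulrDr.
rewrite big_split /=; congr (_ + _).
  case: k {rowE} => -[|k] kN /=.
    by rewrite big1 ?subrr ?mulr0 // => k' _; rewrite mulr0.
  rewrite (bigD1 (Ordinal (ltnW kN))) //= eqxx big1 ?addr0 1?mulrC // => k'.
  rewrite -val_eqE /= => k'k; rewrite eqSS eq_sym (negbTE k'k) mulr0 //.
case: (ltnP k.+1 N.+1) => kN.
  rewrite (bigD1 (Ordinal kN)) //= eqxx big1 ?addr0 1?mulrC // => k'.
  by rewrite -val_eqE /= => /negbTE ->; rewrite mulr0.
have -> : (k : nat) = N by have := ltn_ord k; lia.
rewrite subrr mulr0 mul0r big1 // => k' _.
by case: eqP => [e|_]; rewrite mulr0.
Qed.

(** The value w_k at k = N - m particles, normalised by w_N = 1. The denominator is the product of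
    the downward rates mu (N + k') for k < k' <= N. *)
Definition ehrenfest_eigen N mu x m : R :=
  (ehrenfest_poly N mu m).[x] / (mu ^+ m * ((2 * N) ^_ m)%:R).

(** With m = N - k, the factors 2N - m and m are N + k and N - k, so this is the eigenvector
    equation at k particles; the two rates add up to 2 N mu. *)
Lemma ehrenfest_eigen_rec N mu x m : 0 < mu -> (m < 2 * N)%N ->
  mu * (2 * N%:R - m%:R) * ehrenfest_eigen N mu x m.+1
  + mu * m%:R * ehrenfest_eigen N mu x m.-1 =
  (x + 2 * N%:R * mu) * ehrenfest_eigen N mu x m.
Proof.
move=> mu0 mN; rewrite /ehrenfest_eigen.
have mu1 : mu != 0 by rewrite gt_eqF.
have fE i : (i < 2 * N)%N ->
    ((2 * N) ^_ i.+1)%:R = ((2 * N) ^_ i)%:R * (2 * N%:R - i%:R) :> R.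
  by move=> iN; rewrite ffactnSr natrM natrB ?natrM // ltnW.
have s0 i : (i < 2 * N)%N -> 2 * N%:R - i%:R != 0 :> R.
  by move=> iN; rewrite subr_eq0 -natrM eqr_nat; apply/eqP; lia.
have f0 i : (i <= 2 * N)%N -> ((2 * N) ^_ i)%:R != 0 :> R.
  by move=> iN; rewrite pnatr_eq0 -lt0n ffact_gt0.
case: m mN => [|m] mN.
  rewrite mulr0 mul0r addr0 fE // ffactn0 /= mulr1 hornerD hornerX hornerC hornerC.
  have : N%:R != 0 :> R by rewrite pnatr_eq0; apply/eqP; lia.
  by move: (N%:R : R) => n0 n0_neq0; field; rewrite n0_neq0 mu1.
rewrite [m.+1.-1]/= ehrenfest_polySS hornerD hornerN hornerM hornerZ hornerD hornerX hornerC.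
rewrite (fE m.+1) // (fE m) ?(ltnW mN) // [mu ^+ m.+2]exprS [mu ^+ m.+1]exprS.
have h1 := s0 m (ltnW mN); have h2 := s0 _ mN; have h3 := f0 m (ltnW (ltnW mN)).
have h4 : mu ^+ m != 0 by rewrite expf_neq0.
rewrite -[m.+1%:R]natr1 in h2 *.
move: (_ ^_ _)%:R (mu ^+ m) (_.[x]) (_.[x]) h1 h2 h3 h4 => A0 A1 A2 A3 h1 h2 h3 h4.
field.
by rewrite mu1 h1 h2 h3 h4.
Qed.

(** For N > 0, P(x) = 0 says that the recurrence continued to k = -1 gives w_(-1) = w_0, which
    cancels the downward term that does not exist at k = 0. *)
Lemma ehrenfest_eigen_boundary N mu x : 0 < mu -> root (ehrenfest_P N mu) x ->
  mu * N%:R * (ehrenfest_eigen N mu x N.-1 - ehrenfest_eigen N mu x N) =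
  x * ehrenfest_eigen N mu x N.
Proof.
move=> mu0 rx; have mu1 : mu != 0 by rewrite gt_eqF.
have eG : (ehrenfest_poly N mu N.+1).[x] = mu * N%:R * (ehrenfest_poly N mu N).[x].
  move/rootP: rx; rewrite -ehrenfest_poly_boundary // hornerZ hornerD hornerN hornerZ.
  by move=> /eqP; rewrite mulf_eq0 pnatr_eq0 /= subr_eq0 => /eqP.
case: (posnP N) => [N0|N0].
  move: eG; rewrite /ehrenfest_eigen N0 !mulr0 !mul0r /= mulr1 hornerD hornerX hornerC.
  by rewrite mulr0 mul0r addr0 => ->; rewrite mul0r.
have N2 : (N < 2 * N)%N by lia.
have := ehrenfest_eigen_rec x mu0 N2.
have -> : mu * (2 * N%:R - N%:R) * ehrenfest_eigen N mu x N.+1 =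
    mu * N%:R * ehrenfest_eigen N mu x N.
  rewrite /ehrenfest_eigen eG ffactnSr exprS natrM natrB; last by lia.
  rewrite natrM.
  have h1 : N%:R != 0 :> R by rewrite pnatr_eq0 -lt0n.
  have h2 : ((2 * N) ^_ N)%:R != 0 :> R by rewrite pnatr_eq0 -lt0n ffact_gt0; lia.
  have h3 : mu ^+ N != 0 by rewrite expf_neq0.
  have h4 : 2 * N%:R - N%:R != 0 :> R by rewrite (_ : _ - _ = N%:R) //; ring.
  move: ((2 * N) ^_ N)%:R (mu ^+ N) (N%:R : R) (_.[x]) h1 h2 h3 h4 => A0 A1 A2 A3 h1 h2 h3 h4.
  field.
  by rewrite mu1 h2 h3 h4.
by move=> e; lra.
Qed.

Lemma ehrenfest_eigenfunction N d mu (C : 'M[R]_d) x (i : ehrenfest_state N d) :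
  0 < mu -> stochastic_matrix C -> root (ehrenfest_P N mu) x ->
  \sum_y ehrenfest_rate mu mu C i y *
    (ehrenfest_eigen N mu x (N - y.1) - ehrenfest_eigen N mu x (N - i.1)) =
  x * ehrenfest_eigen N mu x (N - i.1).
Proof.
move=> mu0 stC rx; case: i => k j /=.
rewrite (sum_ehrenfest_rate mu (fun k => ehrenfest_eigen N mu x (N - k))) //.
have kN : (k <= N)%N by rewrite -ltnS.
case: (posnP k) => [->|k0].
  rewrite subn0 subn1 subrr mulr0 add0r subr0.
  exact: ehrenfest_eigen_boundary.
have mN : (N - k < 2 * N)%N by lia.
have := ehrenfest_eigen_rec x mu0 mN.
rewrite (_ : (N - k).+1 = N - k.-1)%N; last by lia.
(* For k = N both sides are truncated to 0, and the coefficient N - k removes the term. *)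
rewrite (_ : (N - k).-1 = N - k.+1)%N; last by lia.
by rewrite natrB // => e; lra.
Qed.

End Generator.

(** * The stationary value and the interpolation weights *)

Section Stationary.
Context {R : realType}.
Implicit Types (N : nat) (mu : R).

(** Both sides equal (2N)! / N!, because (2N + 2) (2N + 1) = 4 (N + 1) (N + 1/2). *)
Lemma central_binomial N :
  'C(2 * N, N)%:R * N`!%:R = 4 ^+ N * \prod_(i < N) (i%:R + 2^-1) :> R.
Proof.
have h : (2 * N)`!%:R = 4 ^+ N * \prod_(i < N) (i%:R + 2^-1) * N`!%:R :> R.
  elim: N => [|N IHN]; first by rewrite big_ord0 !mulr1.
  rewrite (_ : 2 * N.+1 = (2 * N).+2)%N; last by lia.
  rewrite !factS !natrM IHN big_ord_recr /= exprS.
  rewrite -[(2 * N).+2%:R]natr1 -[(2 * N).+1%:R]natr1 -[N.+1%:R]natr1 natrM.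
  by move: (4 ^+ N) (\prod_(i < N) _) (N`!%:R : R) (N%:R : R) => A0 A1 A2 A3; field.
have n0 : N`!%:R != 0 :> R by rewrite pnatr_eq0 -lt0n fact_gt0.
apply: (mulIf n0); rewrite -h -mulrA -!natrM.
by rewrite -(@bin_fact (2 * N) N) ?mul2n -?addnn ?addnK ?leq_addr.
Qed.

Lemma stationary_Gamma N :
  2 * 'C(2 * N, N)%:R / ('C(2 * N, N)%:R + 4 ^+ N) =
  2 / (1 + Num.sqrt pi * N`!%:R / Gamma (N%:R + 2^-1)) :> R.
Proof.
rewrite Gamma_half.
have n0 : 0 < N`!%:R :> R by rewrite ltr0n fact_gt0.
have s0 : 0 < Num.sqrt pi :> R by rewrite sqrtr_gt0 pi_gt0.
have c0 : 0 < \prod_(i < N) (i%:R + 2^-1) :> R.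
  by apply: prodr_gt0 => i _; rewrite ltr_wpDl.
have k0 : 0 < 4 ^+ N :> R by rewrite exprn_gt0.
have -> : 'C(2 * N, N)%:R = 4 ^+ N * \prod_(i < N) (i%:R + 2^-1) / N`!%:R :> R.
  by rewrite -central_binomial mulfK // gt_eqF.
move: (N`!%:R) (Num.sqrt pi) (\prod_(i < N) _) (4 ^+ N) n0 s0 c0 k0.
move=> f s c k n0 s0 c0 k0; field.
by rewrite !gt_eqF // ?addr_gt0 // ?mulr_gt0.
Qed.

(** The term of the root 0 in the expansion. Its denominator is P(x) / x at x = 0, the sum of the
    two products there, which are (4 mu)^N times the product of the i + 1/2 and (4 mu)^N N!. *)
Lemma stationary_residue N mu (alpha : 'I_N.+1 -> R) : 0 < mu ->
  ordered_roots (ehrenfest_P N mu) alpha ->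
  2 * ((ehrenfest_Q N mu).[alpha ord0]
       / (2 * \prod_(s < N.+1 | s != ord0) (alpha ord0 - alpha s))) =
  2 * 'C(2 * N, N)%:R / ('C(2 * N, N)%:R + 4 ^+ N).
Proof.
move=> mu0 oa; have [a0 _ _] := oa.
pose B : {poly R} := \prod_(r < N) ('X + (2 * mu * (2 * r%:R + 2))%:P).
have PE : ehrenfest_P N mu = 'X * (ehrenfest_Q N mu + B) by [].
have -> : 2 * \prod_(s < N.+1 | s != ord0) (alpha ord0 - alpha s) =
    (ehrenfest_Q N mu).[0] + B.[0].
  have := ehrenfest_P_factor mu0 oa.
  rewrite PE (bigD1 ord0) //= a0 subr0 scalerAr => /(mulfI (negbT (polyX_eq0 R))) e.
  rewrite -hornerD e hornerZ horner_prod; congr (_ * _).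
  by apply: eq_bigr => s _; rewrite hornerXsubC.
have h1 : (ehrenfest_Q N mu).[0] = (4 * mu) ^+ N * \prod_(i < N) (i%:R + 2^-1).
  rewrite horner_prod -[in (4 * mu) ^+ N](card_ord N) -prodr_const -big_split /=.
  by apply: eq_bigr => i _; rewrite hornerD hornerX hornerC; field.
have h2 : B.[0] = (4 * mu) ^+ N * N`!%:R.
  rewrite horner_prod -[in (4 * mu) ^+ N](card_ord N) -prodr_const.
  have -> : N`!%:R = \prod_(i < N) i.+1%:R :> R.
    elim: (N) => [|n IHn]; first by rewrite big_ord0.
    by rewrite big_ord_recr /= -IHn factS natrM mulrC.
  rewrite -big_split /=.
  by apply: eq_bigr => i _; rewrite hornerD hornerX hornerC -natr1; ring.
rewrite a0 h1 h2.
have n0 : 0 < N`!%:R :> R by rewrite ltr0n fact_gt0.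
have c0 : 0 < \prod_(i < N) (i%:R + 2^-1) :> R.
  by apply: prodr_gt0 => i _; rewrite ltr_wpDl.
have k0 : 0 < 4 ^+ N :> R by rewrite exprn_gt0.
have m0 : 0 < (4 * mu) ^+ N :> R by rewrite exprn_gt0 // mulr_gt0.
have -> : 'C(2 * N, N)%:R = 4 ^+ N * \prod_(i < N) (i%:R + 2^-1) / N`!%:R :> R.
  by rewrite -central_binomial mulfK // gt_eqF.
move: (N`!%:R) (\prod_(i < N) _) (4 ^+ N) ((4 * mu) ^+ N) n0 c0 k0 m0.
move=> f c k m n0 c0 k0 m0; field.
by rewrite !gt_eqF // ?addr_gt0 // ?mulr_gt0.
Qed.

(* With m = N - k, the right-hand side is the indicator function of the empty
   states. *)
Lemma sum_ehrenfest_eigen N mu (alpha : 'I_N.+1 -> R) m : 0 < mu ->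
  injective alpha -> (m <= N)%N ->
  \sum_k ehrenfest_eigen N mu (alpha k) m
    * (mu ^+ N * ((2 * N) ^_ N)%:R / \prod_(s < N.+1 | s != k) (alpha k - alpha s)) =
  (m == N)%:R.
Proof.
move=> mu0 inj mN.
have [mG sG] := ehrenfest_poly_monic N mu m.
pose c : R := mu ^+ N * ((2 * N) ^_ N)%:R / (mu ^+ m * ((2 * N) ^_ m)%:R).
have := @sum_divided_difference R N (c *: ehrenfest_poly N mu m) alpha inj.
rewrite (leq_trans (size_scale_leq _ _)) ?sG // => /(_ isT).
(* The polynomial is of degree m, so its coefficient of degree N is 0 for m < N; for m = N it is
   monic and [c] is 1. *)
rewrite coefZ; have -> : c * (ehrenfest_poly N mu m)`_N = (m == N)%:R.
  case: eqVneq => [mN'|mN'].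
    have := monicP mG; rewrite /lead_coef sG /= -mN' => ->.
    rewrite mulr1 /c -mN' divff // mulf_neq0 ?expf_neq0 ?gt_eqF //.
    by rewrite ltr0n ffact_gt0; lia.
  by rewrite nth_default ?mulr0 // sG ltn_neqAle mN'.
move=> <-; apply: eq_bigr => k _.
rewrite /ehrenfest_eigen hornerZ /c.
by move: (mu ^+ N * _) (_^-1) (_^-1) (_.[_]) => A0 A1 A2 A3; ring.
Qed.

End Stationary.

(** * The law of the chain and the formula for p(0,t) *)

Lemma chain_prob_in (R : realType) (S : finType) (disp : measure_display)
    (T : measurableType disp) (P : probability T R) (X : R -> T -> S)
    (q : S -> S -> R) (i : S) :
  continuous_time_markov_chain P X q -> P [set w | X 0 w = i] = 1%E ->
  exists p, [/\ transition_function p, has_rates p q &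
    forall t j, 0 <= t -> prob_in P X t j = p t i j].
Proof.
move=> [mX [p [tp pq mp]]] P1; exists p; split=> // t j t0.
(* Markov property at time 0 with an empty list of earlier observations; conditioning on an event of
   probability 1 then changes nothing. *)
have := mp 0%N (fun=> 0) (fun=> i) 0 t i j _ (lexx 0) t0.
rewrite add0r => /(_ _)/wrap[|e]; first by case.
have A1 : [set w | (forall m : 'I_0, X 0 w = i) /\ X 0 w = i] = [set w | X 0 w = i].
  by apply/seteqP; split=> w /= => [[]|->] //; split=> // -[].
have A2 : [set w | [/\ forall m : 'I_0, X 0 w = i, X 0 w = i & X t w = j]] =
    [set w | X t w = j] `&` [set w | X 0 w = i].
  by apply/seteqP; split=> w /= => [[]|[? ?]] //; split=> // -[].
rewrite A1 A2 P1 mul1r in e; rewrite -e /prob_in.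
have mA := mX 0 i (lexx 0); have mB := mX t j t0.
have P0 : P ([set w | X t w = j] `\` [set w | X 0 w = i]) = 0%E.
  apply/eqP; rewrite eq_le measure_ge0 andbT.
  have <- : P (~` [set w | X 0 w = i]) = 0%E.
    by rewrite probability_setC // P1 subee.
  apply: le_measure; rewrite ?inE; [exact: measurableD|exact: measurableC|].
  by move=> w [].
by congr fine; rewrite -[RHS]add0e -P0; exact: measureDI.
Qed.

Theorem proposition3p4 (R : realType) (N d : nat) (lambda mu : R)
    (C : 'M[R]_d) (l0 : 'I_d)
    (disp : measure_display) (T : measurableType disp) (P : probability T R)
    (X : R -> T -> ehrenfest_state N d) :
  lambda = mu -> 0 < mu ->
  stochastic_matrix C ->
  continuous_time_markov_chain P X (ehrenfest_rate lambda mu C) ->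
  P [set w | X 0 w = (ord0, l0)] = 1%E ->
  (exists alpha : 'I_N.+1 -> R, ordered_roots (ehrenfest_P N mu) alpha) /\
  forall alpha : 'I_N.+1 -> R, ordered_roots (ehrenfest_P N mu) alpha ->
    let beta := fun k : 'I_N.+1 =>
      2 * \prod_(s < N.+1 | s != k) (alpha k - alpha s) in
    let rho0 := 2 * 'C(2 * N, N)%:R / ('C(2 * N, N)%:R + 4 ^+ N) in
    [/\ forall k : 'I_N.+1,
          (ehrenfest_P N mu).[eta] / (eta - alpha k) @[eta --> (alpha k)^'] --> beta k,
        forall t : R, 0 <= t ->
          prob_count P X ord0 t =
          rho0 + 2 * \sum_(k < N.+1 | k != ord0)
                       (ehrenfest_Q N mu).[alpha k] / beta k * expR (alpha k * t),
        prob_count P X ord0 t @[t --> +oo] --> rho0 &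
        rho0 = 2 / (1 + Num.sqrt pi * N`!%:R / Gamma (N%:R + 2^-1))].
Proof.
move=> -> {lambda} mu0 stC chain start; split; first exact: ehrenfest_roots_exist.
move=> alpha oa beta rho0.
have inj := ordered_roots_inj oa.
have PE := ehrenfest_P_factor mu0 oa.
have [a0 lt_alpha rootE] := oa.
have alpha_le0 k : alpha k <= 0.
  case: (eqVneq k ord0) => [->|k0]; first by rewrite a0.
  by rewrite -a0 ltW // lt_alpha // lt0n.
have prob_empty t : 0 <= t -> prob_count P X ord0 t =
    rho0 + 2 * \sum_(k < N.+1 | k != ord0)
                 (ehrenfest_Q N mu).[alpha k] / beta k * expR (alpha k * t).
  move=> t0.
  have [p [tp pq Pp]] := chain_prob_in chain start.
  pose c k : R := mu ^+ N * ((2 * N) ^_ N)%:R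
    / \prod_(s < N.+1 | s != k) (alpha k - alpha s).
  have -> : prob_count P X ord0 t =
      \sum_y p t (ord0, l0) y * \sum_k ehrenfest_eigen N mu (alpha k) (N - y.1) * c k.
    rewrite /prob_count.
    transitivity (\sum_(k' < N.+1) \sum_(j < d) p t (ord0, l0) (k', j) * (k' == ord0)%:R).
      rewrite (bigD1 ord0) //= [X in _ + X]big1 ?addr0; last first.
        by move=> k' /negbTE ->; apply: big1 => j _; rewrite mulr0.
      by apply: eq_bigr => j _; rewrite Pp // mulr1.
    rewrite pair_big /=; apply: eq_bigr => -[k' j] _ /=; congr (_ * _).
    rewrite (sum_ehrenfest_eigen mu0 inj (leq_subr _ _)).
    have k'N := ltn_ord k'; congr (nat_of_bool _)%:R.
    by rewrite -val_eqE /=; apply/eqP/eqP; lia.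
  (* Exchanging the sums lets each eigenfunction evolve by its exponential. *)
  have -> : \sum_y p t (ord0, l0) y
        * (\sum_k ehrenfest_eigen N mu (alpha k) (N - y.1) * c k) =
      \sum_k 2 * ((ehrenfest_Q N mu).[alpha k] / beta k) * expR (alpha k * t).
    under eq_bigr do rewrite mulr_sumr.
    rewrite exchange_big /=; apply: eq_bigr => k _.
    have rk : root (ehrenfest_P N mu) (alpha k) by apply/rootE; exists k.
    have := transition_eigenfunction
      (F := fun y : ehrenfest_state N d => ehrenfest_eigen N mu (alpha k) (N - y.1))
      tp pq (alpha_le0 k) _ (ord0, l0) t0.
    move=> /(_ _)/wrap[|e].
      by move=> i; exact: ehrenfest_eigenfunction.
    under eq_bigr do rewrite mulrA.
    (* The initial state is empty, so m = N and the eigenfunction there is Q(alpha_k) over its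
       normalising constant, which [c] cancels. *)
    rewrite -mulr_suml e /= subn0 /c /beta /ehrenfest_eigen ehrenfest_poly_middle //.
    have b0 : \prod_(s < N.+1 | s != k) (alpha k - alpha s) != 0.
      apply/prodf_neq0 => s sk; rewrite subr_eq0; apply: contra sk => /eqP/inj ->.
      by rewrite eqxx.
    have f0 : ((2 * N) ^_ N)%:R != 0 :> R by rewrite pnatr_eq0 -lt0n ffact_gt0; lia.
    have m0 : mu ^+ N != 0 by rewrite expf_neq0 ?gt_eqF.
    move: (\prod_(s < N.+1 | _) _) ((2 * N) ^_ N)%:R (mu ^+ N) b0 f0 m0 => b f m b0 f0 m0.
    by field; rewrite b0 f0 m0.
  rewrite (bigD1 ord0) //= a0 mul0r expR0 mulr1 -{1}a0 stationary_residue //.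
  by congr (_ + _); rewrite mulr_sumr; apply: eq_bigr => k _; rewrite !mulrA.
split=> //.
(* [q] is the exact quotient of P by ['X - (alpha k)%:P], so the limit is its value by
   continuity. *)
- move=> k; pose q : {poly R} := 2 *: \prod_(s < N.+1 | s != k) ('X - (alpha s)%:P).
  have -> : beta k = q.[alpha k].
    rewrite /q hornerZ horner_prod; congr (_ * _).
    by apply: eq_bigr => s _; rewrite hornerXsubC.
  apply: cvg_trans (cvg_within_filter _ (@continuous_horner _ q (alpha k))).
  apply: near_eq_cvg; near=> x.
  have xk : x - alpha k != 0.
    rewrite subr_eq0; near: x; exact: nbhs_dnbhs_neq.
  rewrite PE (bigD1 k) //= scalerAr hornerM hornerXsubC.
  by rewrite mulrAC divff // mul1r.
(* Every root other than [alpha ord0] is negative, so only the constant term survives. *)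
- have cv : rho0 + 2 * \sum_(k < N.+1 | k != ord0)
      (ehrenfest_Q N mu).[alpha k] / beta k * expR (alpha k * t) @[t --> +oo] -->
      rho0 + 2 * \sum_(k < N.+1 | k != ord0) (ehrenfest_Q N mu).[alpha k] / beta k * 0.
    apply: cvgD; first exact: cvg_cst.
    apply: cvgMl_tmp; apply: cvg_sumr => k k0; apply: cvgMl_tmp.
    have ak : 0 < - alpha k by rewrite oppr_gt0 -a0 lt_alpha // lt0n.
    have ty : (fun t : R => - alpha k * t) t @[t --> +oo%R] --> +oo%R.
      exact: (gt0_cvgMry ak cvg_id).
    have := cvg_comp _ _ ty (@cvgr_expR R).
    move=> h; apply: cvg_trans h; apply: near_eq_cvg; near=> t.
    by rewrite /= mulNr opprK.
  rewrite big1 ?mulr0 ?addr0 in cv; last by move=> k _; rewrite mulr0.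
  apply: cvg_trans cv; apply: near_eq_cvg; near=> t.
  by rewrite prob_empty //; near: t; apply: nbhs_pinfty_ge; exact: num_real.
- exact: stationary_Gamma.
Unshelve. all: by end_near. Qed.
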